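(* Let $I\subset\mathbb{R}$ be an interval with interior $I^{\circ}$, let $f:I\to\mathbb{R}$ be twice differentiable on $I^{\circ}$, let $a,b\in I^{\circ}$ with $a<b$, and suppose $f''\in L_1[a,b]$. Let $c,y,d$ be real numbers with $0\le c\le y\le d\le 1$ and $0<y<1$. Let $q>1$ and let $p$ be defined by $\frac1p+\frac1q=1$. If $|f''|^q$ is convex on $[a,b]$, then $$\left|\frac{(c-y)^2-(d-y)^2}{2}(a-b)f'(ya+(1-y)b)+\frac{(d-1)^2f'(a)-c^2f'(b)}{2}(a-b)+(c-d)f(ya+(1-y)b)+\bigl[(d-1)f(a)-cf(b)\bigr]+\frac{1}{b-a}\int_a^b f(x)\,dx\right|$$ $$\le\frac{(b-a)^2}{2}\left(\frac{1}{2p+1}\right)^{1/p}\left\{\left(c^{2p+1}+(y-c)^{2p+1}\right)^{1/p}\left(\frac{y^2|f''(a)|^q+(2y-y^2)|f''(b)|^q}{2}\right)^{1/q}+\left((d-y)^{2p+1}+(1-d)^{2p+1}\right)^{1/p}\left(\frac{(1-y^2)|f''(a)|^q+(1-y)^2|f''(b)|^q}{2}\right)^{1/q}\right\}.$$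
   Context: $L_1[a,b]$ denotes the space of Lebesgue integrable functions on $[a,b]$. *)

(* Defs.v *)
From mathcomp Require Export all_boot all_order all_algebra.
From mathcomp Require Export all_classical all_reals all_analysis.

(* Main.v *)
Require Import Defs.
From mathcomp Require Import all_boot all_order all_algebra.
From mathcomp Require Import all_classical all_reals all_analysis.
From mathcomp Require Import ring lra.
Import Order.TTheory GRing.Theory Num.Theory.
Import numFieldNormedType.Exports.
Local Open Scope ring_scope.
Local Open Scope classical_set_scope.

(** The weighted expression bounded here is the remainder of a corrected
    trapezoid formula with a quadratic Peano kernel. With x(t) = t a + (1-t) b,
    two integrations by parts turn it into
      (b-a)^2/2 ( int_0^y (t-c)^2 f''(x(t)) dt + int_y^1 (t-d)^2 f''(x(t)) dt ),
    and Hoelder's inequality on each of the two pieces gives the bound: the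
    kernel contributes int (t-e)^(2p), and convexity gives
    |f''(x(t))|^q <= t |f''(a)|^q + (1-t) |f''(b)|^q, an affine function of t
    whose integral is explicit.

    The proof runs this argument on primitives and their increments. The
    integral of (t-e)^2 f''(x(t)) becomes the increment of the explicit function
    [kernel_primitive], whose derivative is that
    integrand and whose boundary values assemble into the left-hand side
    ([kernel_primitive_increments_sum]). Hoelder's inequality is replaced by a
    version for increments ([holder_increment]): if |f'| <= u v, u^p <= g' and
    v^q <= h', then the increment of f is at most the product of the increment
    of g to the 1/p and that of h to the 1/q. It follows from the mean value
    theorem and Young's inequality, scaled in the optimal way. Here the
    primitives g and h of the two majorants are explicit, so the only integral
    left is that of the continuous function f, handled by the fundamental
    theorem of calculus ([antiderivative_exists]). *)

(** * Hoelder's inequality for increments *)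

(** The only delicate point is 0, where the difference quotient is |h|^r, which
    tends to 0 because r > 0; negative points reduce to positive ones since the
    function is odd. *)
Lemma is_derive_signed_power {R : realType} (r x : R) : 0 < r ->
  is_derive x 1 (fun z : R => z * `|z| `^ r) ((r + 1) * `|x| `^ r).
Proof.
move=> r0.
have pos (z : R) : 0 < z ->
    is_derive z 1 (fun z : R => z * `|z| `^ r) ((r + 1) * `|z| `^ r).
  move=> z0; apply: (@near_eq_is_derive _ _ _ (fun w : R => w * w `^ r)).
    near=> w; rewrite ger0_norm//; near: w.
    by apply: filterS (lt_nbhsr z0) => w /ltW.
  have := is_deriveM (is_derive_id z (1 : R)) (is_derive1_powR r z0).
  move/is_derive_eq; apply.
  rewrite gtr0_norm// /GRing.scale/= mulr1 mulrCA mulr_powRB1 ?ltW//.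
  by rewrite mulrDl mul1r.
have [x0|x0|->] := ltgtP x 0; last first.
- have lim : h^-1 *: (((fun z : R => z * `|z| `^ r) \o shift 0) (h *: 1)
      - 0 * `|0 : R| `^ r) @[h --> (0 : R)^'] --> (0 : R).
    apply/cvgrPdist_lt => e e0; near=> h.
    have h0 : h != 0 by near: h; exact: nbhs_dnbhs_neq.
    rewrite /= addr0 mul0r subr0 /GRing.scale/= mulr1 mulKf// sub0r normrN.
    rewrite ger0_norm ?powR_ge0//.
    rewrite -[e]powRr1 ?ltW// -(mulVf (lt0r_neq0 r0)) powRrM.
    rewrite gt0_ltr_powR ?nnegrE ?powR_ge0//.
    near: h; apply: dnbhs0_lt; exact: powR_gt0.
  split; first by apply/cvg_ex; exists 0.
  by rewrite normr0 powR0 ?gt_eqF// mulr0; exact: cvg_lim.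
- exact: pos.
- have := is_derive1_comp (pos (- x) _) (is_deriveNid x (1 : R)).
  rewrite oppr_gt0 => /(_ x0)/is_deriveN; rewrite normrN.
  move=> H; have := is_derive_eq H _; move/(_ ((r + 1) * `|x| `^ r)).
  rewrite mulrN1 opprK => /(_ erefl).
  by apply: near_eq_is_derive; near=> w => /=; rewrite fctE/= normrN mulNr opprK.
Unshelve. all: by end_near. Qed.

(** Both g - f and g + f have a nonnegative derivative. *)
Lemma ler_norm_increment {R : realType} (f df g dg : R -> R) (s t : R) :
  s <= t ->
  (forall x : R, s <= x <= t -> is_derive x 1 f (df x)) ->
  (forall x : R, s <= x <= t -> is_derive x 1 g (dg x)) ->
  (forall x : R, s <= x <= t -> `|df x| <= dg x) ->
  `|f t - f s| <= g t - g s.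
Proof.
move=> st fd gd dfg.
have incr (h dh : R -> R) :
    (forall x : R, s <= x <= t -> is_derive x 1 h (dh x)) ->
    (forall x : R, s <= x <= t -> 0 <= dh x) -> 0 <= h t - h s.
  move=> hd dh0.
  have [||z] := @MVT_segment R h dh s t st.
  - by move=> z; rewrite in_itv/= => /andP[/ltW sz /ltW zt]; apply: hd; rewrite sz.
  - by apply: derivable_within_continuous => z; rewrite in_itv => /hd[].
  - by rewrite in_itv/= => zst ->; rewrite mulr_ge0 ?subr_ge0// dh0.
have := incr (fun z => g z + f z) (fun z => dg z + df z).
have := incr (fun z => g z - f z) (fun z => dg z - df z).
move=> hB hD; rewrite ler_norml; apply/andP; split.
- suff : 0 <= g t + f t - (g s + f s) by lra.
  apply: hD => z zst; first by apply: is_deriveD; [exact: gd|exact: fd].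
  by have := dfg z zst; rewrite ler_norml => /andP[]; lra.
- suff : 0 <= g t - f t - (g s - f s) by lra.
  apply: hB => z zst; first by apply: is_deriveB; [exact: gd|exact: fd].
  by have := dfg z zst; rewrite ler_norml => /andP[]; lra.
Qed.

(** Young's inequality for u/k and v/l bounds |f'| by a combination of g' and h',
    hence the increment of f by the same combination of the increments P of g
    and Q of h. The choice k = P^(1/p), l = Q^(1/q) makes the combination equal
    to P^(1/p) Q^(1/q). If P or Q vanishes this choice is not available, and
    letting k or l tend to 0 shows that f has no increment. *)
Lemma holder_increment {R : realType} (p q : R)
    (f df g dg h dh u v : R -> R) (s t : R) :
  0 < p -> 0 < q -> p^-1 + q^-1 = 1 -> s <= t ->
  (forall x : R, s <= x <= t -> is_derive x 1 f (df x)) ->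
  (forall x : R, s <= x <= t -> is_derive x 1 g (dg x)) ->
  (forall x : R, s <= x <= t -> is_derive x 1 h (dh x)) ->
  (forall x : R, s <= x <= t -> 0 <= u x) ->
  (forall x : R, s <= x <= t -> 0 <= v x) ->
  (forall x : R, s <= x <= t -> `|df x| <= u x * v x) ->
  (forall x : R, s <= x <= t -> u x `^ p <= dg x) ->
  (forall x : R, s <= x <= t -> v x `^ q <= dh x) ->
  `|f t - f s| <= (g t - g s) `^ p^-1 * (h t - h s) `^ q^-1.
Proof.
move=> p0 q0 pq st fd gd hd u0 v0 fuv gu hv.
have young (k l : R) : 0 < k -> 0 < l -> `|f t - f s| <=
    k * l * ((g t - g s) / (p * k `^ p) + (h t - h s) / (q * l `^ q)).
  move=> k0 l0.
  pose A := k * l / (p * k `^ p); pose B := k * l / (q * l `^ q).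
  have -> : k * l * ((g t - g s) / (p * k `^ p) + (h t - h s) / (q * l `^ q)) =
      (A * g t + B * h t) - (A * g s + B * h s) by rewrite /A /B; ring.
  have kp0 : 0 < k `^ p by exact: powR_gt0.
  have lq0 : 0 < l `^ q by exact: powR_gt0.
  apply: (@ler_norm_increment _ f df (fun x => A * g x + B * h x)
    (fun x => A * dg x + B * dh x) _ _ st fd) => x xst.
    apply: is_deriveD; first by apply: is_deriveZ; exact: gd.
    by apply: is_deriveZ; exact: hd.
  apply: (le_trans (fuv _ xst)).
  have -> : u x * v x = k * l * ((u x / k) * (v x / l)).
    by field; rewrite !gt_eqF.
  have uk0 : 0 <= u x / k by exact: divr_ge0 (u0 _ xst) (ltW k0).
  have vl0 : 0 <= v x / l by exact: divr_ge0 (v0 _ xst) (ltW l0).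
  have := conjugate_powR uk0 vl0 p0 q0 pq.
  have divP (w e r : R) : 0 <= w -> 0 < e -> (w / e) `^ r = w `^ r / e `^ r.
    move=> w0 e0; rewrite powRM ?invr_ge0 ?(ltW e0)//.
    by rewrite -(powR_inv1 (ltW e0)) -powRrM mulN1r powRN.
  rewrite (divP _ _ _ (u0 _ xst) k0) (divP _ _ _ (v0 _ xst) l0) => H.
  have kl0 : 0 <= k * l by exact: mulr_ge0 (ltW k0) (ltW l0).
  apply: (le_trans (ler_wpM2l kl0 H)).
  have -> : k * l * (u x `^ p / k `^ p / p + v x `^ q / l `^ q / q) =
     A * u x `^ p + B * v x `^ q.
    by rewrite /A /B; field; rewrite !gt_eqF.
  by rewrite lerD// ler_wpM2l ?gu ?hv// /A /B divr_ge0 ?mulr_ge0// ltW.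
(* g and h are nondecreasing, as their derivatives dominate powers. *)
have ge0 (w dw z : R -> R) (r : R) :
    (forall x : R, s <= x <= t -> is_derive x 1 w (dw x)) ->
    (forall x : R, s <= x <= t -> z x `^ r <= dw x) -> 0 <= w t - w s.
  move=> wd wz; apply: (le_trans (normr_ge0 (0 - 0 : R))).
  apply: (@ler_norm_increment _ (cst 0) (cst 0) w dw _ _ st _ wd) => x xst.
  by rewrite normr0 (le_trans _ (wz _ xst)) ?powR_ge0.
have := ge0 _ _ _ _ gd gu; have := ge0 _ _ _ _ hd hv.
set P := g t - g s; set Q := h t - h s => Q0 P0.
have vanish (c : R) : (forall e, 0 < e -> `|f t - f s| <= e * c) ->
    `|f t - f s| <= 0.
  move=> H; apply/ler_addgt0Pl => e e0; rewrite addr0.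
  have c0 : 0 < `|c| + 1 by rewrite ltr_wpDl.
  apply: (le_trans (H (e / (`|c| + 1)) (divr_gt0 e0 c0))).
  rewrite mulrAC ler_pdivrMr// (ler_wpM2l (ltW e0))//.
  by rewrite (le_trans (ler_norm c))// lerDl.
have [P00|Pn0] := eqVneq P 0.
  rewrite P00 powR0 ?invr_eq0 ?gt_eqF// mul0r.
  apply: (vanish (Q / q)) => e e0; apply: (le_trans (young e 1 e0 ltr01)).
  by rewrite -/P -/Q P00 mul0r add0r powR1 !mulr1.
have [Q00|Qn0] := eqVneq Q 0.
  rewrite Q00 powR0 ?invr_eq0 ?gt_eqF// mulr0.
  apply: (vanish (P / p)) => e e0; apply: (le_trans (young 1 e ltr01 e0)).
  by rewrite -/P -/Q Q00 mul0r addr0 powR1 mulr1 mul1r.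
have {}P0 : 0 < P by rewrite lt_neqAle eq_sym Pn0.
have {}Q0 : 0 < Q by rewrite lt_neqAle eq_sym Qn0.
apply: (le_trans (young _ _ (powR_gt0 p^-1 P0) (powR_gt0 q^-1 Q0))).
rewrite -/P -/Q -!powRrM !mulVf ?gt_eqF// (powRr1 (ltW P0)) (powRr1 (ltW Q0)).
have -> : P / (p * P) + Q / (q * Q) = p^-1 + q^-1 by field; rewrite !gt_eqF.
by rewrite pq mulr1.
Qed.

(** * The antiderivative of the integrand *)

(** The integral is started strictly to the left of a, and f is integrable
    strictly beyond b, so that F has a two-sided derivative at a and b too. *)
Lemma antiderivative_exists {R : realType} (f : R -> R) (a' a b b' : R) :
  a' < a -> a < b -> b < b' ->
  (forall x : R, a' < x < b' -> derivable f x 1) ->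
  exists F : R -> R,
    (forall x : R, a <= x <= b -> is_derive x 1 F (f x)) /\
    \int[@lebesgue_measure R]_(x in `[a, b]) f x = F b - F a.
Proof.
move=> a'a ab bb' fd.
pose m := (a' + a) / 2; pose n := (b + b') / 2.
have cont (u v : R) : a' < u -> v < b' -> {within `[u, v], continuous f}.
  move=> u0 v0; apply: derivable_within_continuous => x.
  rewrite in_itv/= => /andP[ux xv]; apply: fd.
  by rewrite (lt_le_trans u0 ux) (le_lt_trans xv v0).
have [ma nb] : a' < m < a /\ b < n < b' by rewrite /m /n; lra.
have intf : (@lebesgue_measure R).-integrable `[m, n] (EFin \o f).
  apply: continuous_compact_integrable; first exact: segment_compact.
  by apply: cont; lra.
pose F (x : R) := \int[@lebesgue_measure R]_(t in `[m, x]) f t.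
have Fd (x : R) : a <= x <= b -> is_derive x 1 F (f x).
  move=> axb.
  have [||||dF F'] := @continuous_FTC1_closed R f m x n.
  - by lra.
  - exact: intf.
  - by lra.
  - by apply: differentiable_continuous; apply/derivable1_diffP; apply: fd; lra.
  by split; [exact: dF|rewrite -derive1E].
exists F; split => //.
rewrite /Rintegral (@continuous_FTC2 _ f F a b)//.
- by apply: cont.
- have Fc (x : R) : a <= x <= b -> {for x, continuous F}.
    by move=> /Fd[dF _]; apply: differentiable_continuous; exact/derivable1_diffP.
  split.
  + by move=> x; rewrite in_itv/= => /andP[ax xb]; have [] := Fd x; rewrite ?ltW.
  + by apply: cvg_at_right_filter; apply: Fc; rewrite lexx ltW.
  + by apply: cvg_at_left_filter; apply: Fc; rewrite lexx ltW.
- by move=> x; rewrite in_itv/= => /andP[ax xb]; rewrite derive1E;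
    apply: derive_val; apply: Fd; rewrite !ltW.
Qed.

(** * The quadratic Peano kernel *)

(** The primitive of (t - e)^2 f''(x), x = t a + (1 - t) b, obtained by two
    integrations by parts, where f1 stands for f' and F for a primitive of f. *)
Definition kernel_primitive {R : realType} (F f f1 : R -> R) (a b e t : R) : R :=
  let x := t * a + (1 - t) * b in
  (t - e) ^+ 2 / (a - b) * f1 x - 2 * (t - e) / (b - a) ^+ 2 * f x
  - 2 / (b - a) ^+ 3 * F x.

Lemma is_derive_kernel_primitive {R : realType} (F f f1 f2 : R -> R)
    (a b e t : R) : a < b ->
  let x := t * a + (1 - t) * b in
  is_derive x 1 F (f x) -> is_derive x 1 f (f1 x) -> is_derive x 1 f1 (f2 x) ->
  is_derive t 1 (kernel_primitive F f f1 a b e) ((t - e) ^+ 2 * f2 x).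
Proof.
move=> ab x Fd fd f1d.
pose X := fun t : R => t * a + (1 - t) * b.
have Xd : is_derive t (1 : R) X (a - b).
  rewrite /X; apply: is_derive_eq.
  rewrite /GRing.scale/=; ring.
have := is_derive1_comp (f := F) (g := X) Fd Xd.
have := is_derive1_comp (f := f) (g := X) fd Xd.
have := is_derive1_comp (f := f1) (g := X) f1d Xd.
move=> D1 D0 DF.
have k2 : is_derive t (1 : R) (fun t : R => (t - e) ^+ 2 / (a - b)) (2 * (t - e) / (a - b)).
  apply: is_derive_eq; rewrite /GRing.scale/=; ring.
have k1 : is_derive t (1 : R) (fun t : R => 2 * (t - e) / (b - a) ^+ 2) (2 / (b - a) ^+ 2).
  apply: is_derive_eq; rewrite /GRing.scale/=; ring.
have := is_deriveB (is_deriveB (is_deriveM k2 D1) (is_deriveM k1 D0))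
  (is_deriveZ (2 / (b - a) ^+ 3) DF).
move/is_derive_eq; apply.
rewrite /GRing.scale/= -[X t]/x; field.
by rewrite !subr_eq0 (gt_eqF ab) (lt_eqF ab).
Qed.

(** Since t = 0 and t = 1 give b and a, the boundary terms at the junction
    t = y and at the two ends add up to the expression to be estimated; the
    terms in F at y cancel. *)
Lemma kernel_primitive_increments_sum {R : realType} (F f f1 : R -> R)
    (a b c y d : R) : a < b ->
  let m := y * a + (1 - y) * b in
  let Phi := kernel_primitive F f f1 a b in
  (b - a) ^+ 2 / 2 * ((Phi c y - Phi c 0) + (Phi d 1 - Phi d y)) =
  ((c - y) ^+ 2 - (d - y) ^+ 2) / 2 * (a - b) * f1 m
    + ((d - 1) ^+ 2 * f1 a - c ^+ 2 * f1 b) / 2 * (a - b)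
    + (c - d) * f m + ((d - 1) * f a - c * f b)
    + (b - a)^-1 * (F b - F a).
Proof.
move=> ab m Phi; rewrite /Phi /kernel_primitive -/m.
have -> : 0 * a + (1 - 0) * b = b by ring.
have -> : 1 * a + (1 - 1) * b = a by ring.
have : b - a != 0 by rewrite subr_eq0 (gt_eqF ab).
rewrite -(opprB b a); move: (b - a) => w w0.
by field.
Qed.

(** Hoelder for increments with u = (t - e)^2 and v = |f''|. The primitives are
    U, for the power |t - e|^(2p), and V, for the affine majorant of |f''|^q;
    as e lies between s and t, the two signed powers in U add up. *)
Lemma kernel_primitive_increment {R : realType} (p q : R) (F f f1 f2 : R -> R)
    (a b A B e s t : R) :
  0 < p -> 0 < q -> p^-1 + q^-1 = 1 -> a < b -> 0 <= s -> s <= e <= t -> t <= 1 ->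
  (forall x : R, a <= x <= b -> is_derive x 1 F (f x)) ->
  (forall x : R, a <= x <= b -> is_derive x 1 f (f1 x)) ->
  (forall x : R, a <= x <= b -> is_derive x 1 f1 (f2 x)) ->
  (forall z : R, 0 <= z <= 1 ->
    `|f2 (z * a + (1 - z) * b)| `^ q <= z * A + (1 - z) * B) ->
  `|kernel_primitive F f f1 a b e t - kernel_primitive F f f1 a b e s| <=
    (((e - s) `^ (2 * p + 1) + (t - e) `^ (2 * p + 1)) / (2 * p + 1)) `^ p^-1
    * (((t ^+ 2 - s ^+ 2) * A + ((1 - s) ^+ 2 - (1 - t) ^+ 2) * B) / 2) `^ q^-1.
Proof.
move=> p0 q0 pq ab s0 /andP[se et] t1 Fd fd f1d f2AB.
have st := le_trans se et.
have in01 (z : R) : s <= z <= t -> 0 <= z <= 1 by lra.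
have inab (z : R) : s <= z <= t -> a <= z * a + (1 - z) * b <= b.
  by move=> /in01 ?; nra.
pose U (z : R) : R := (2 * p + 1)^-1 * ((z - e) * `|z - e| `^ (2 * p)).
pose V (z : R) : R := (z ^+ 2 * A - (1 - z) ^+ 2 * B) / 2.
have p20 : 0 < 2 * p by rewrite mulr_gt0.
have p210 : 0 < 2 * p + 1 by rewrite addr_gt0.
have -> : ((e - s) `^ (2 * p + 1) + (t - e) `^ (2 * p + 1)) / (2 * p + 1)
    = U t - U s.
  have powS (w : R) : 0 <= w -> w `^ (2 * p + 1) = w * `|w| `^ (2 * p).
    by move=> w0; rewrite ger0_norm// -[2 * p in RHS](addrK 1) mulr_powRB1.
  rewrite /U -[s - e]opprB normrN !powS ?subr_ge0//; ring.
have -> : ((t ^+ 2 - s ^+ 2) * A + ((1 - s) ^+ 2 - (1 - t) ^+ 2) * B) / 2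
    = V t - V s by rewrite /V; ring.
apply: (@holder_increment _ p q _
  (fun z : R => (z - e) ^+ 2 * f2 (z * a + (1 - z) * b))
  U (fun z : R => `|z - e| `^ (2 * p))
  V (fun z : R => z * A + (1 - z) * B)
  (fun z : R => (z - e) ^+ 2) (fun z : R => `|f2 (z * a + (1 - z) * b)|) _ _ p0 q0 pq st).
- move=> z zst; apply: (is_derive_kernel_primitive _ _ _ _ _ _ _ _ ab).
  + by apply: Fd; exact: inab.
  + by apply: fd; exact: inab.
  + by apply: f1d; exact: inab.
- move=> z _.
  have Ed : is_derive z (1 : R) (fun z : R => z - e) 1.
    by apply: is_derive_eq; rewrite subr0.
  have := is_derive1_comp
    (f := fun w : R => w * `|w| `^ (2 * p)) (g := fun z : R => z - e)
    (is_derive_signed_power (2 * p) (z - e) p20) Ed.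
  move/(is_deriveZ (2 * p + 1)^-1)/is_derive_eq; apply.
  by rewrite mulr1 /GRing.scale/= mulKf// gt_eqF.
- move=> z _; rewrite /V; apply: is_derive_eq.
  by rewrite /GRing.scale/=; field.
- by move=> z _; exact: sqr_ge0.
- by move=> z _; exact: normr_ge0.
- by move=> z _; rewrite normrM ger0_norm ?sqr_ge0.
- by move=> z _; rewrite -real_normK ?num_real// -powR_mulrn// -powRrM.
- by move=> z zst; apply: f2AB; exact: in01.
Qed.

(** * The inequality *)

(** Points slightly to the left of a and to the right of b still lie in I, and
    the open interval between them is then an open subset of I. *)
Lemma itv_interior_nbhd_segment {R : realType} (I : interval R) (a b : R) :
  ([set` I] : set R)° a -> ([set` I] : set R)° b ->
  exists a' b' : R, [/\ a' < a, b < b' &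
    forall x : R, a' < x < b' -> ([set` I] : set R)° x].
Proof.
move=> /nbhs_ballP[u /= u0 Iu] /nbhs_ballP[v /= v0 Iv].
exists (a - u / 2), (b + v / 2); split; [lra|lra|].
have Ia' : [set` I] (a - u / 2).
  by apply: Iu; rewrite /ball/= opprB addrC subrK gtr0_norm; lra.
have Ib' : [set` I] (b + v / 2).
  by apply: Iv; rewrite /ball/= opprD addNKr normrN gtr0_norm; lra.
have sub : `]a - u / 2, b + v / 2[%classic `<=` ([set` I] : set R)°.
  rewrite -open_subsetE; last exact: interval_open.
  move=> x; rewrite /= in_itv/= => /andP[ax xb].
  by apply: (interval_is_interval Ia' Ib'); rewrite !ltW.
by move=> x axb; apply: sub; rewrite /= in_itv.
Qed.

Theorem theorem9 (R : realType) (I : interval R) (f : R -> R)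
  (f_derivable : forall x : R, ([set` I] : set R)° x -> derivable f x 1)
  (f'_derivable : forall x : R, ([set` I] : set R)° x -> derivable f^`() x 1)
  (a b : R) (Ia : ([set` I] : set R)° a) (Ib : ([set` I] : set R)° b) (ab : a < b)
  (f''_L1 : (@lebesgue_measure R).-integrable `[a, b] (EFin \o f^`(2)))
  (c y d : R)
  (c_ge0 : 0 <= c) (cy : c <= y) (yd : y <= d) (d_le1 : d <= 1)
  (y_gt0 : 0 < y) (y_lt1 : y < 1)
  (q p : R) (q_gt1 : 1 < q) (pq : p^-1 + q^-1 = 1)
  (f''_convex :
     convex_function (`[a, b] : set R^o) (fun x : R^o => `|f^`(2) x| `^ q)) :
  `| ((c - y) ^+ 2 - (d - y) ^+ 2) / 2 * (a - b) * derive1 f (y * a + (1 - y) * b)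
     + ((d - 1) ^+ 2 * derive1 f a - c ^+ 2 * derive1 f b) / 2 * (a - b)
     + (c - d) * f (y * a + (1 - y) * b)
     + ((d - 1) * f a - c * f b)
     + (b - a)^-1 * \int[@lebesgue_measure R]_(x in `[a, b]) f x |
  <= (b - a) ^+ 2 / 2 * (1 / (2 * p + 1)) `^ p^-1
     * ( (c `^ (2 * p + 1) + (y - c) `^ (2 * p + 1)) `^ p^-1
         * ((y ^+ 2 * `|derive1n 2 f a| `^ q
             + (2 * y - y ^+ 2) * `|derive1n 2 f b| `^ q) / 2) `^ q^-1
       + ((d - y) `^ (2 * p + 1) + (1 - d) `^ (2 * p + 1)) `^ p^-1
         * (((1 - y ^+ 2) * `|derive1n 2 f a| `^ q
             + (1 - y) ^+ 2 * `|derive1n 2 f b| `^ q) / 2) `^ q^-1 ).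
Proof.
have sqrB : 1 - (1 - y) ^+ 2 = 2 * y - y ^+ 2 by ring.
have q0 : 0 < q by rewrite (lt_trans ltr01).
have p0 : 0 < p.
  rewrite -invr_gt0; have : q^-1 < 1 by rewrite invf_lt1.
  by move: pq; lra.
have [a' [b' [a'a bb' I0]]] := itv_interior_nbhd_segment I a b Ia Ib.
have inI (x : R) : a <= x <= b -> ([set` I] : set R)° x.
  by move=> axb; apply: I0; lra.
have fd (x : R) : a <= x <= b -> is_derive x 1 f (f^`() x).
  by move=> /inI/f_derivable fx; split; [exact: fx|rewrite derive1E].
have f1d (x : R) : a <= x <= b -> is_derive x 1 f^`() (f^`(2) x).
  by move=> /inI/f'_derivable fx; split; [exact: fx|rewrite -derive1E].
have [F [Fd intF]] := antiderivative_exists f a' a b b' a'a ab bb'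
  (fun x xab => f_derivable x (I0 x xab)).
have f2AB (z : R) : 0 <= z <= 1 ->
    `|f^`(2) (z * a + (1 - z) * b)| `^ q
    <= z * `|f^`(2) a| `^ q + (1 - z) * `|f^`(2) b| `^ q.
  move=> /andP[z0 z1].
  have := f''_convex (Itv01 z0 z1) a b.
  by rewrite !inE/= !in_itv/= !lexx (ltW ab) => /(_ isT isT).
(* The kernel is centred at c on [0, y] and at d on [y, 1]. *)
have incr := kernel_primitive_increment p q F f f^`() f^`(2) a b
  (`|f^`(2) a| `^ q) (`|f^`(2) b| `^ q).
have incr1 := incr c 0 y p0 q0 pq ab (lexx 0) _ (ltW y_lt1) Fd fd f1d f2AB.
have incr2 := incr d y 1 p0 q0 pq ab (ltW y_gt0) _ (lexx 1) Fd fd f1d f2AB.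
have {incr1} := incr1 _; rewrite c_ge0 cy => /(_ isT).
have {incr2 incr} := incr2 _; rewrite yd d_le1 => /(_ isT).
set D2 := _ - _; set D1 := kernel_primitive _ _ _ _ _ c _ - _ => H2 H1.
set S := (X in `|X| <= _).
have -> : S = (b - a) ^+ 2 / 2 * (D1 + D2).
  by rewrite /S /D1 /D2 kernel_primitive_increments_sum// intF.
rewrite normrM ger0_norm ?divr_ge0 ?sqr_ge0// -mulrA.
apply: ler_wpM2l; first by rewrite divr_ge0 ?sqr_ge0.
apply: (le_trans (ler_normD _ _)); rewrite mulrDr.
have p210 : 0 < 2 * p + 1 by rewrite addr_gt0 ?mulr_gt0.
have scale (w : R) : 0 <= w ->
    (w / (2 * p + 1)) `^ p^-1 = (1 / (2 * p + 1)) `^ p^-1 * w `^ p^-1.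
  by move=> w0; rewrite -powRM ?divr_ge0 ?(ltW p210)// mul1r mulrC.
apply: lerD.
- apply: (le_trans H1); rewrite scale ?addr_ge0 ?powR_ge0// -mulrA.
  by rewrite !subr0 expr1n expr0n subr0 sqrB.
- apply: (le_trans H2); rewrite scale ?addr_ge0 ?powR_ge0// -mulrA.
  by rewrite subrr expr0n expr1n subr0.
Qed.
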